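(* For integers $n>3$ and $1\le k<n$, the $k$-derangement graph $\Gamma_{k,n}$ is connected.
   Context: $S_n$ is the symmetric group on $[n]=\{1,\dots,n\}$. For $\sigma\in S_n$, $\sigma_{(k)}$ denotes the induced permutation of the set of $k$-element subsets of $[n]$, $\sigma_{(k)}(\{a_1,\dots,a_k\})=\{\sigma(a_1),\dots,\sigma(a_k)\}$; $\sigma$ is a $k$-derangement if $\sigma_{(k)}$ fixes no $k$-element subset. Let $\mathcal{D}_{k,n}$ be the set of $k$-derangements in $S_n$ (it is closed under inverses). The $k$-derangement graph $\Gamma_{k,n}$ is the Cayley graph $\Gamma(S_n,\mathcal{D}_{k,n})$: its vertices are the elements of $S_n$, and $u,v$ are adjacent iff $su=v$ for some $s\in\mathcal{D}_{k,n}$. *)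

(* Defs.v *)
From HB Require Import structures.
From mathcomp Require Import all_boot all_order all_fingroup.

Set Implicit Arguments.
Unset Strict Implicit.
Unset Printing Implicit Defensive.

Import GroupScope.

(* 'S_n acts on 'I_n = {0, ..., n - 1}, standing for [n]. The induced
   permutation of k-subsets sends A to its image s @: A. *)
Definition kderangement (k n : nat) (s : 'S_n) : bool :=
  [forall A : {set 'I_n}, (#|A| == k) ==> (s @: A != A)].

Definition kderangements (k n : nat) : {set 'S_n} :=
  [set s | kderangement k s].

Definition cayley_graph (gT : finGroupType) (S : {set gT}) : rel gT :=
  fun u v => [exists s in S, s * u == v].

(* (s * u) x = u (s x) in 'S_n; since kderangements k n is stable under
   conjugation, composing in the other order gives the same relation. *)
Definition kderangement_graph (k n : nat) : rel 'S_n :=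
  cayley_graph (kderangements k n).
Arguments kderangement_graph : clear implicits.

(* connect e is directed reachability; for symmetric e, such as
   kderangement_graph k n, this is ordinary graph connectedness. *)
Definition connected_graph (T : finType) (e : rel T) : Prop :=
  forall u v : T, connect e u v.

Lemma kderangementsV (k n : nat) (s : 'S_n) :
  s \in kderangements k n -> s^-1 \in kderangements k n.
Proof.
rewrite !inE => /forallP sD; apply/forallP => A; apply/implyP => cA.
have /implyP/(_ cA) := sD A; apply: contra => /eqP eA.
rewrite -{1}eA -imset_comp; apply/eqP.
by rewrite -[RHS]imset_id; apply: eq_imset => x /=; rewrite permKV.
Qed.

Lemma kderangement_graph_sym (k n : nat) :
  symmetric (kderangement_graph k n).
Proof.
suff H u v : kderangement_graph k n u v -> kderangement_graph k n v u.
  by move=> u v; apply/idP/idP; apply: H.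
case/existsP => s /andP[sD /eqP <-]; apply/existsP; exists s^-1.
by rewrite kderangementsV //= mulKg.
Qed.

Lemma kderangement_graph_composition (k n : nat) (u v : 'S_n) :
  kderangement_graph k n u v = [exists s in kderangements k n, u * s == v].
Proof.
have DJ (s x : 'S_n) : s \in kderangements k n -> s ^ x \in kderangements k n.
  rewrite !inE => /forallP sD; apply/forallP => A; apply/implyP => cA.
  have cxA : #|x^-1 @: A| == k by rewrite card_imset //; apply: perm_inj.
  have /implyP/(_ cxA) := sD (x^-1 @: A); apply: contra => /eqP eA.
  apply/eqP; rewrite -{2}eA -!imset_comp; apply: eq_imset => y /=.
  by rewrite conjgE !permM permK.
apply/existsP/existsP => -[s /andP[sD /eqP <-]].
  by exists (s ^ u); rewrite DJ //= conjgE mulKVg.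
by exists (s ^ u^-1); rewrite DJ //= conjgE invgK mulgA mulgKV.
Qed.

(* Main.v *)
Require Import Defs.
From mathcomp Require Import all_boot all_order all_fingroup.
From mathcomp Require Import zify.

Import GroupScope.

(** Let [c] be the long cycle [0 -> 1 -> ... -> n-1 -> 0].  Multiplying it by
    the transposition [(0 j)] splits it into two cycles of lengths [j] and
    [n - j], whose stable sets have [0], [j], [n - j] or [n] elements.  Since
    [n > 3], one of [j = 1] and [j = 2] makes this product a [k]-derangement, as
    [c] always is; so a transposition is a quotient of two [k]-derangements.
    The set of [k]-derangements is stable under conjugation, so this holds for
    every transposition, and transpositions generate ['S_n]. *)

Lemma card_ord_ltn (n j : nat) : j <= n -> #|[set i : 'I_n | i < j]| = j.
Proof.
by move=> le_jn;
  rewrite -sum1dep_card (big_ord_narrow le_jn) sum1_card card_ord.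
Qed.

(** Membership in [A] can change only between [j - 1] and [j], so [A] is a union of the blocks
    [[0, j)] and [[j, n)]. *)
Lemma card_locally_constant (n j : nat) (A : {set 'I_n}) : j < n ->
    (forall i i' : 'I_n, i' = i.+1 :> nat -> i' != j :> nat ->
      (i' \in A) = (i \in A)) ->
  #|A| \in [:: 0; j; n - j; n].
Proof.
move=> lt_jn stA; pose B := [set i : 'I_n | i < j].
have cB : #|B| = j by apply: card_ord_ltn; apply: ltnW.
have cCB : #|~: B| = n - j by rewrite cardsCs setCK cB card_ord.
pose o := Ordinal (leq_ltn_trans (leq0n j) lt_jn); pose oj := Ordinal lt_jn.
have memA (i : 'I_n) : (i \in A) = if i < j then o \in A else oj \in A.
  case: i => m; elim: m => [|m IHm] lt_mn /=.
    case: (posnP j) => [j0|_]; congr (_ \in A); exact: val_inj.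
  have [eq_j|ne_j] := eqVneq m.+1 j.
    by rewrite -eq_j ltnn; congr (_ \in A); apply: val_inj; rewrite /= eq_j.
  rewrite (stA (Ordinal (ltnW lt_mn))) // IHm /=.
  by rewrite [m.+1 < j]ltn_neqAle ne_j.
have [oA|oA] := boolP (o \in A); have [jA|jA] := boolP (oj \in A).
- suff -> : A = setT by rewrite cardsT card_ord !inE eqxx !orbT.
  by apply/setP => i; rewrite memA oA jA inE if_same.
- suff -> : A = B by rewrite cB !inE eqxx !orbT.
  by apply/setP => i; rewrite memA oA (negPf jA) inE; case: ifP.
- suff -> : A = ~: B by rewrite cCB !inE eqxx !orbT.
  by apply/setP => i; rewrite memA (negPf oA) jA !inE; case: ifP.
- suff -> : A = set0 by rewrite cards0 !inE eqxx.
  by apply/setP => i; rewrite memA (negPf oA) (negPf jA) inE if_same.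
Qed.

(** The values of [s] at [j - 1] and [n - 1] are left free, which covers both the long cycle
    ([j = 0]) and its split product. *)
Lemma kderangement_of_shift (n j k : nat) (s : 'S_n) : j < n ->
    (forall i i' : 'I_n, i' = i.+1 :> nat -> i' != j :> nat -> s i = i') ->
    k \notin [:: 0; j; n - j; n] ->
  s \in kderangements k n.
Proof.
move=> lt_jn shift_s k_notin; rewrite inE; apply/forallP => A.
apply/implyP => /eqP cA; apply: contra k_notin => /eqP sA.
rewrite -cA; apply: card_locally_constant => // i i' ii' i'j.
by rewrite -(shift_s i i' ii' i'j) -{1}sA mem_imset //; apply: perm_inj.
Qed.

(** Right translations preserve any such Cayley graph; left ones do so because the connection set is
    stable under conjugation. *)
Lemma kderangement_graphM (k n : nat) (g u v h : 'S_n) :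
  kderangement_graph k n u v ->
  kderangement_graph k n (g * u * h) (g * v * h).
Proof.
case/existsP => s /andP[sD /eqP <-].
have /existsP[s' /andP[s'D /eqP eg]] : kderangement_graph k n g (g * s).
  rewrite kderangement_graph_composition; apply/existsP; exists s.
  by rewrite sD eqxx.
by apply/existsP; exists s'; rewrite s'D /= !mulgA eg.
Qed.

Lemma tperm_conj_ex (T : finType) (a b x y : T) :
  a != b -> x != y -> exists p : {perm T}, tperm a b ^ p = tperm x y.
Proof.
move=> ab xy; exists (tperm a x * tperm (tperm a x b) y).
(* The second factor fixes [x], which is neither [y] nor the image of [b]. *)
rewrite tpermJ !permM tpermL tpermL tpermD // 1?eq_sym //.
by rewrite -{1}(tpermL a x) (inj_eq perm_inj).
Qed.

Lemma tperm_quotient_kderangements (n k : nat) :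
    3 < n -> 1 <= k -> k < n ->
  exists a b (c d : 'S_n), [/\ a != b, c \in kderangements k n,
    d \in kderangements k n & tperm a b = c^-1 * d].
Proof.
(* Cycle lengths [1] and [n - 1] fail only for [k = 1] or [k = n - 1]; then [2] and [n - 2] both
   differ from [k], as [n > 3]. *)
move=> n_gt3 k_gt0 lt_kn; pose j := (if (k == 1) || (k == n.-1) then 2 else 1)%N.
have [j_gt0 lt_jn] : 0 < j /\ j < n by rewrite /j; case: ifP => _; lia.
pose o : 'I_n := Ordinal (ltn_trans j_gt0 lt_jn).
pose oj : 'I_n := Ordinal lt_jn.
have kj : k \notin [:: 0; j; n - j; n].
  by rewrite /j !inE; case: ifP; lia.
have k0 : k \notin [:: 0; 0; n - 0; n] by rewrite !inE; lia.
pose c : 'S_n := perm (@ordS_inj n).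
have shift_c (i i' : 'I_n) : i' = i.+1 :> nat -> c i = i'.
  by move=> ii'; apply: val_inj; rewrite permE /= -ii' modn_small //.
exists o, oj, c, (c * tperm o oj); split; last by rewrite mulKg.
- by rewrite -val_eqE neq_ltn /= j_gt0.
- by apply: kderangement_of_shift k0 => [|i i' ii' _]; [lia | apply: shift_c].
- apply: kderangement_of_shift kj => // i i' ii' i'j.
  (* [i'] is a successor, hence not [0], and is not [j]: the transposition fixes it. *)
  rewrite permM (shift_c i i' ii') tpermD // -val_eqE /= 1?eq_sym //.
  by rewrite ii'.
Qed.

Theorem theorem1 (n k : nat) (hn : 3 < n) (hk1 : 1 <= k) (hkn : k < n) :
  connected_graph (kderangement_graph k n).
Proof.
have [a [b [c [d [ab cD dD tcd]]]]] :=
  tperm_quotient_kderangements n k hn hk1 hkn.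
have connT x y u : x != y ->
    connect (kderangement_graph k n) u (tperm x y * u).
  case/(tperm_conj_ex _ _ _ _ _ ab) => p <-.
  (* The path [1], [d], [c^-1 * d = tperm a b] is translated by [p^-1] on the left and [p * u] on
     the right. *)
  have /(kderangement_graphM _ _ p^-1 _ _ (p * u)) e1d :
      kderangement_graph k n 1 d.
    by apply/existsP; exists d; rewrite dD mulg1 eqxx.
  have /(kderangement_graphM _ _ p^-1 _ _ (p * u)) edt :
      kderangement_graph k n d (tperm a b).
    by apply/existsP; exists c^-1; rewrite kderangementsV // tcd eqxx.
  rewrite mulg1 mulKg in e1d.
  rewrite conjgE -!mulgA [p^-1 * _]mulgA.
  exact: connect_trans (connect1 e1d) (connect1 edt).
move=> u v; have [ts vu /allP tsP] := prod_tpermP (v * u^-1).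
rewrite -(mulgKV u v) vu; elim: ts tsP {vu} => [|t ts IHts] tsP.
  by rewrite big_nil mul1g.
rewrite big_cons -mulgA; apply: connect_trans (connT _ _ _ (tsP t _)).
  by apply: IHts => t' ts_t'; apply: tsP; rewrite inE ts_t' orbT.
by rewrite inE eqxx.
Qed.
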